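(* Let $X$ be a charming (Tychonoff) space with a Lindelöf $\Sigma$ kernel $Y$, and put $B=\overline{Y}^{\,X}$ (the closure of $Y$ in $X$). Let $\mathsf{Obs}_{cc}(Y,B)$ be the set of all points $x\in B\setminus Y$ such that for every open neighborhood $U$ of $x$ in $X$ the subspace $U\cap Y$ is not countably compact, and let $H=\overline{\mathsf{Obs}_{cc}(Y,B)}^{\,B}$ be its closure in $B$. Then for every open set $U\subseteq B$ (open in $B$) with $H\subseteq U$, the closed subspace $B\setminus U$ is a $D$-space. Consequently, $B$ is a $D$-space if and only if $H$ is a $D$-space; and likewise $X$ is a $D$-space if and only if $H$ is a $D$-space.
   Context: All spaces are Tychonoff (completely regular and Hausdorff); subsets carry the subspace topology. A space $X$ is a $D$-space if for every neighborhood assignment $\varphi$ (a map assigning to each $x\in X$ an open set $\varphi(x)\ni x$) there is a closed discrete set $D\subseteq X$ with $X=\bigcup_{d\in D}\varphi(d)$. A space $Z$ is Lindelöf $\Sigma$ if there are a second countable Tychonoff space $M$ and a map $\Phi$ from $M$ to the nonempty compact subsets of $Z$ that is upper semicontinuous (for each open $U\subseteq Z$, $\{m\in M:\Phi(m)\subseteq U\}$ is open in $M$) with $Z=\bigcup_{m\in M}\Phi(m)$. A space $X$ is charming if it has a Lindelöf $\Sigma$ subspace $Y$ such that for every open $U\subseteq X$ with $Y\subseteq U$, the subspace $X\setminus U$ is Lindelöf $\Sigma$; such a $Y$ is called a Lindelöf $\Sigma$ kernel of $X$. Countably compact means every countable open cover has a finite subcover. *)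

(* Defs.v *)
From mathcomp Require Import all_boot all_order all_classical topology urysohn.

Set Implicit Arguments.
Unset Strict Implicit.
Unset Printing Implicit Defensive.

Local Open Scope classical_set_scope.

(* A subspace [A : set X] is the topological space [set_type A], whose topology
   is induced by the inclusion; [subspace A] is a different object (its carrier
   is the whole of [X]). *)

(* [completely_regular_space] does not include a separation axiom; by
   [uniform_separatorP], it is separation by continuous real functions. *)
Definition tychonoff_space (X : topologicalType) : Prop :=
  completely_regular_space X /\ hausdorff_space X.

Definition neighborhood_assignment (X : topologicalType) (phi : X -> set X)
    : Prop :=
  forall x : X, open_nbhs x (phi x).

Definition discrete_set (X : topologicalType) (D : set X) : Prop :=
  D `<=` isolated D.

Definition D_space (X : topologicalType) : Prop :=
  forall phi : X -> set X, neighborhood_assignment phi ->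
    exists D : set X, [/\ closed D, discrete_set D &
      \bigcup_(d in D) phi d = [set: X]].

Definition usc_map (M Z : topologicalType) (Phi : M -> set Z)
    : Prop :=
  forall U : set Z, open U -> open [set m : M | Phi m `<=` U].

Definition lindelof_sigma (Z : topologicalType) : Prop :=
  exists (M : topologicalType) (Phi : M -> set Z),
    [/\ @second_countable M, tychonoff_space M,
        forall m : M, Phi m !=set0 /\ compact (Phi m),
        usc_map Phi &
        \bigcup_(m in [set: M]) Phi m = [set: Z]].

Definition lindelof_sigma_kernel (X : topologicalType) (Y : set X) : Prop :=
  lindelof_sigma (set_type Y) /\
  forall U : set X, open U -> Y `<=` U -> lindelof_sigma (set_type (~` U)).

Definition charming_space (X : topologicalType) : Prop :=
  exists Y : set X, lindelof_sigma_kernel Y.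

Definition countably_compact (X : topologicalType) : Prop :=
  forall C : set (set X), countable C -> C `<=` open ->
    \bigcup_(U in C) U = [set: X] ->
    exists F : set (set X), [/\ finite_set F, F `<=` C &
      \bigcup_(U in F) U = [set: X]].

Definition Obs_cc (X : topologicalType) (Y B : set X) : set (set_type B) :=
  [set x : set_type B | ~ Y (set_val x) /\
    forall U : set X, open_nbhs (set_val x) U ->
      ~ countably_compact (set_type (U `&` Y))].

Arguments Obs_cc {X} Y B.

(* Main.v *)
(* If [x] lies in [closure Y] but not in [Y], then [Y] is covered by countably
   many members of a network modulo compact sets whose closures miss [x];
   hence no trace [U `&` Y] of a neighborhood of [x] is countably compact.
   So [Obs_cc Y B] is the whole of [B `\` Y], and a closed subset of [B] that
   avoids [H] is a closed subset of [Y], hence Lindelof Sigma, hence a D-space.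
   The equivalences follow by peeling: treat [H] first, then the part of [B]
   left uncovered, then the part of [X] left uncovered, which is Lindelof Sigma
   by the kernel property. *)
Require Import Defs.
From HB Require Import structures.
From mathcomp Require Import all_boot all_order finmap all_classical.
From mathcomp Require Import topology urysohn.

Local Open Scope classical_set_scope.

(** * Closed discrete sets and the relative D-property *)

(** A local form of being closed and discrete, from which stability under subsets and finite unions
    is immediate. *)
Definition closed_discrete {X : topologicalType} (D : set X) : Prop :=
  forall x, exists2 V, open_nbhs x V & V `&` D `<=` [set x].

Lemma closed_discreteP {X : topologicalType} (D : set X) :
  closed_discrete D <-> closed D /\ discrete_set D.
Proof.
split=> [cdD|[cD dD] x].
  split=> [x clDx|x Dx].
    have [V /open_nbhs_nbhs Vx VD] := cdD x.
    have [y [Dy Vy]] := clDx V Vx.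
    by rewrite -(VD y).
  split; first exact/mem_set.
  have [V /[dup] /open_nbhs_nbhs Vx [_ Vx'] VD] := cdD x.
  exists V => //; apply/seteqP; split=> // _ ->; by split.
have [Dx|nDx] := pselect (D x).
  have [_ [V]] := dD x Dx.
  rewrite nbhsE => -[W Wx WV] VD.
  by exists W => // y [Wy Dy]; rewrite -VD; split => //; exact: WV.
exists (~` D) => [|y []//].
by split=> //; exact: closed_openC.
Qed.

Lemma closed_discreteU {X : topologicalType} (D E : set X) :
  closed_discrete D -> closed_discrete E -> closed_discrete (D `|` E).
Proof.
move=> cD cE x.
have [V [oV Vx] VD] := cD x; have [W [oW Wx] WE] := cE x.
exists (V `&` W); first by split; [exact: openI|].
by move=> y [[Vy Wy] [Dy|Ey]]; [exact: VD|exact: WE].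
Qed.

Lemma closed_discrete_sub {X : topologicalType} (D E : set X) :
  D `<=` E -> closed_discrete E -> closed_discrete D.
Proof.
move=> DE cE x; have [V Vx VE] := cE x.
by exists V => // y [Vy /DE Ey]; exact: VE.
Qed.

(* For closed [A], the D-property of the subspace [A], stated inside [X]. *)
Definition D_subset {X : topologicalType} (A : set X) : Prop :=
  forall phi : X -> set X, (forall x, A x -> open_nbhs x (phi x)) ->
    exists D : set X, [/\ D `<=` A, closed_discrete D &
      A `<=` \bigcup_(d in D) phi d].

Lemma D_subset_setT {X : topologicalType} :
  D_space X <-> D_subset [set: X].
Proof.
split=> DX phi phiX.
  have [D [cD dD DT]] := DX phi (fun x => phiX x I).
  by exists D; split; [|exact/closed_discreteP|rewrite DT].
have [D [_ /closed_discreteP[cD dD] DT]] := DX phi (fun x _ => phiX x).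
by exists D; split => //; apply/seteqP; split.
Qed.

Lemma D_subset_closed {X : topologicalType} (A B : set X) :
  closed A -> A `<=` B -> D_subset B -> D_subset A.
Proof.
move=> cA AB DB phi phiA.
(* Points off [A] receive the complement of [A], which covers nothing of [A]; so the centers lying
   in [A] already cover [A]. *)
pose psi x := if pselect (A x) then phi x else ~` A.
have [|D [DsubB cD BD]] := DB psi.
  move=> x _; rewrite /psi; case: pselect => [/phiA//|nAx].
  by split=> //; exact: closed_openC.
exists (D `&` A); split; [exact: subIsetr| |].
  exact: closed_discrete_sub cD.
move=> x Ax; have [d Dd] := BD x (AB x Ax).
by rewrite /psi; case: pselect => // Ad phid; exists d.
Qed.

(** The peeling step: the neighborhoods chosen for [A] form an open [U] around [A], and a second
    closed discrete set handles what [U] leaves uncovered. *)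
Lemma D_subset_glue {X : topologicalType} {A B : set X} :
  A `<=` B -> D_subset A ->
  (forall U, open U -> A `<=` U -> D_subset (B `\` U)) -> D_subset B.
Proof.
move=> AB DA DBU phi phiB.
have [D [DsubA cD AD]] := DA phi (fun x Ax => phiB x (AB x Ax)).
set U := \bigcup_(d in D) phi d in AD.
have oU : open U.
  by apply: bigcup_open => d /DsubA/AB/phiB[].
have [E [EB cE BE]] := DBU U oU AD phi (fun x Bx => phiB x (proj1 Bx)).
exists (D `|` E); split.
- by move=> x [/DsubA/AB//|/EB[]].
- exact: closed_discreteU.
- move=> x Bx; have [[d Dd dx]|nUx] := pselect (U x).
    by exists d => //; left.
  by have [|e Ee ex] := BE x; [split|exists e => //; right].
Qed.

(** * Closed embeddings *)

Definition closed_embedding {Z X : topologicalType} (f : Z -> X) : Prop :=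
  [/\ injective f, closed (range f) &
      forall U : set Z, open U <-> exists2 V, open V & f @^-1` V = U].

Lemma closed_embedding_image {Z X : topologicalType} {f : Z -> X}
    {A : set Z} :
  closed_embedding f -> closed A -> closed (f @` A).
Proof.
move=> [fI cf fo] cA.
have [V oV fV] : exists2 V, open V & f @^-1` V = ~` A.
  by apply/fo; exact: closed_openC.
have -> : f @` A = range f `&` ~` V.
  apply/seteqP; split=> [_ [z Az <-]|_ [[z _ <-] nV]].
    by split=> // Vz; have : (~` A) z by rewrite -fV.
  exists z => //; apply: contrapT => nAz; apply: nV.
  by have : (~` A) z by []; rewrite -fV.
by apply: closedI => //; exact: open_closedC.
Qed.

Lemma closed_embedding_comp {Z Y X : topologicalType} (f : Z -> Y)
    (g : Y -> X) :
  closed_embedding f -> closed_embedding g -> closed_embedding (g \o f).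
Proof.
move=> [fI cf fo] ge; have [gI _ go] := ge; split.
- exact: inj_comp.
- by rewrite -(image_comp f g); exact: closed_embedding_image ge cf.
- move=> U; rewrite fo; split.
    by move=> [V /go[W oW <-] <-]; exists W.
  by move=> [W oW <-]; exists (g @^-1` W) => //; apply/go; exists W.
Qed.

Lemma range_set_val {T : Type} (A : set T) :
  range (set_val : set_type A -> T) = A.
Proof.
apply/seteqP; split=> [_ [x _ <-]|x Ax]; first exact: set_valP.
by exists (SigSub (mem_set Ax)).
Qed.

Lemma set_val_closed_embedding {X : topologicalType} (A : set X) :
  closed A -> closed_embedding (set_val : set_type A -> X).
Proof.
move=> cA; split.
- exact: val_inj.
- by rewrite range_set_val.
- by [].
Qed.

(** An assignment on the range pulls back along [f]; one on [Z] lifts to open sets of [X] with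
    traces inside it. As the range is closed, images of closed discrete sets stay closed discrete in
    [X]. *)
Lemma closed_embedding_D {Z X : topologicalType} {f : Z -> X} :
  closed_embedding f -> D_space Z <-> D_subset (range f).
Proof.
move=> [fI cf fo]; rewrite D_subset_setT; split=> DZ phi phio.
  have [|D [_ cD DT]] := DZ (fun z => f @^-1` (phi (f z))).
    move=> z _; have [//|ophi phiz] := phio (f z).
    by split=> //; apply/fo; exists (phi (f z)).
  exists (f @` D); split.
  - by move=> _ [z _ <-]; exists z.
  - move=> x; have [[z _ <-]|nx] := pselect (range f x).
      have [W [/fo[V oV VW] Wz] WD] := cD z.
      exists V => [|y [Vy [d Dd dy]]]; first by split=> //; rewrite -VW in Wz.
      by rewrite -dy; congr f; apply: WD; rewrite -VW; split=> //=; rewrite dy.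
    exists (~` range f); first by split=> //; exact: closed_openC.
    by move=> y [nd [d _ dE]]; case: nd; exists d.
  - by move=> _ [z _ <-]; have [d Dd dz] := DT z I; exists (f d).
have /choice[psi psiP] : forall x, exists W, range f x ->
    open_nbhs x W /\ forall z, f z = x -> f @^-1` W `<=` phi z.
  move=> x; have [[z _ <-]|nx] := pselect (range f x); last by exists setT.
  have [//|/fo[W oW WE] phiz] := phio z.
  exists W => _; split; first by split=> //; rewrite -WE in phiz.
  by move=> y /fI ->; rewrite WE.
have [|D [DsubR cD DT]] := DZ psi; first by move=> x /psiP[].
exists (f @^-1` D); split => //.
  move=> z; have [V [oV Vz] VD] := cD (f z).
  exists (f @^-1` V); first by split=> //; apply/fo; exists V.
  by move=> y /VD /= /fI.
move=> z _; have [|x Dx xz] := DT (f z); first by exists z.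
have [d _ dE] := DsubR x Dx; exists d; first by rewrite /= dE.
have [|_ psix] := psiP x; first by exists d.
exact: psix xz.
Qed.

(** * Countable networks modulo compact sets *)

(* The Lindelof Sigma property, as a countable network modulo compact sets. *)
Definition sigma_subset {X : topologicalType} (A : set X) : Prop :=
  exists2 C : set (set X), countable C &
    forall x, A x -> exists K, [/\ compact K, K `<=` A &
      forall U, open U -> K `<=` U -> exists N, [/\ C N, N x & N `<=` U]].

(** The network consists of the images under [Phi] of the members of a countable base of [M]; upper
    semicontinuity puts one of them inside any open set around [Phi m]. *)
Lemma lindelof_sigma_subset {X : topologicalType} (A : set X) :
  lindelof_sigma (set_type A) -> sigma_subset A.
Proof.
move=> [M [Phi [[B cB [Bo Bb]] _ PhiK Phiu PhiT]]].
have vc : continuous (set_val : set_type A -> X) by exact: initial_continuous.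
pose net (b : set M) : set X := set_val @` \bigcup_(m in b) Phi m.
exists (net @` B); first exact: sub_countable (card_image_le _ _) _.
move=> x Ax.
have [m _ mx] : (\bigcup_(m in [set: M]) Phi m) (SigSub (mem_set Ax)).
  by rewrite PhiT.
exists (set_val @` Phi m); split.
- apply: continuous_compact; last exact: (PhiK m).2.
  exact: continuous_subspaceT.
- by move=> _ [a _ <-]; exact: set_valP.
- move=> U oU KU.
  have oV : open (set_val @^-1` U : set (set_type A)).
    by apply: open_comp => // ? _; exact: vc.
  have : nbhs m [set m | Phi m `<=` set_val @^-1` U].
    apply: open_nbhs_nbhs; split; first exact: Phiu.
    by move=> a am; apply: KU; exists a.
  move=> /Bb[b [Bb' bm] bU].
  exists (net b); split; first by exists b.
    by exists (SigSub (mem_set Ax)) => //; exists m.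
  by move=> _ [a [k bk ka] <-]; exact: (bU k bk).
Qed.

Lemma sigma_subset_closed {X : topologicalType} (A F : set X) :
  closed F -> F `<=` A -> sigma_subset A -> sigma_subset F.
Proof.
move=> cF FA [C cC AC]; exists ((fun N => N `&` F) @` C).
  exact: sub_countable (card_image_le _ _) _.
move=> x Fx; have [K [cK KA KC]] := AC x (FA x Fx).
exists (K `&` F); split; [exact: compact_closedI|exact: subIsetr|].
move=> U oU KU.
(* Adding the complement of [F] makes the open set contain all of [K], and intersecting with [F]
   removes it again. *)
have [||N [CN Nx NU]] := KC (U `|` ~` F).
- by apply: openU => //; exact: closed_openC.
- by move=> y Ky; have [Fy|] := pselect (F y); [left; apply: KU|right].
exists (N `&` F); split=> //; first by exists N.
by move=> y [/NU[]].
Qed.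

Lemma compact_finite_subcover {X : topologicalType} {K D : set X}
    (phi : X -> set X) :
  compact K -> (forall x, D x -> open (phi x)) ->
  K `<=` \bigcup_(x in D) phi x ->
  exists E, [/\ finite_set E, E `<=` D & K `<=` \bigcup_(x in E) phi x].
Proof.
move=> cK phio KD.
have [[x0 _]|K0] := pselect (K !=set0); last first.
  by exists set0; split=> // x Kx; case: K0; exists x.
(* [compact_cover] is stated for pointed spaces only. *)
pose T : ptopologicalType := HB.pack (X : Type) X (isPointed.Build X x0).
have : @cover_compact T K by rewrite -compact_cover.
move=> /(_ X D phi phio KD)[E ED KE].
exists [set` E]; split=> // x /ED; exact: set_mem.
Qed.

(* A closed discrete [D] is built in countably many finite steps, each disjoint
   from what is already covered; step [n] completes the cover of the network
   member [N n] whenever finitely many uncovered points suffice.  As every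
   network member recurs infinitely often, a point [x] left uncovered would have
   its compact set, hence some network member around [x], covered after all. *)
Lemma sigma_subset_D {X : topologicalType} (A : set X) :
  accessible_space X -> closed A -> sigma_subset A -> D_subset A.
Proof.
move=> aX cA [C cC AC] phi phiA.
have [N CN] : exists N : nat -> set X, forall S, C S ->
    forall n, exists2 m, (n <= m)%N & N m = S.
  have /countable_injP[h hI] := cC.
  (* The 2-adic valuation of [m] codes a member of [C]; the factor [3 ^ n] below makes the index at
     least [n] without changing that valuation. *)
  exists (fun m => xget set0 [set S | C S /\ h S = logn 2 m]) => S CS n.
  exists (2 ^ h S * 3 ^ n)%N.
    apply: (leq_trans (ltnW (ltn_expl n (isT : 1 < 3)%N))).
    by rewrite leq_pmull // expn_gt0.
  rewrite lognM ?expn_gt0 // pfactorK // lognX muln0 addn0.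
  case: xgetP => [S' _ [CS' hS']|/(_ S)[]//].
  by apply: hI => //; exact: mem_set.
pose cov (E : set X) := \bigcup_(d in E) phi d.
pose good n (P E : set X) := [/\ finite_set E, E `<=` A, E `&` cov P = set0 &
  N n `<=` cov P `|` cov E].
(* When no [E] qualifies, the default [set0] adds nothing and keeps the first three clauses of
   [good]. *)
pose step n P := xget set0 (good n P).
have stepP n P : [/\ finite_set (step n P), step n P `<=` A &
    step n P `&` cov P = set0].
  by rewrite /step; case: xgetP => [E _ []//|_]; split=> //; rewrite set0I.
pose fix acc n := if n is n'.+1 then acc n' `|` step n' (acc n') else set0.
have acc_fin n : finite_set (acc n).
  elim: n => //= n IH; rewrite finite_setU; split=> //.
  by case: (stepP n (acc n)).
have accS m n : (m <= n)%N -> acc m `<=` acc n.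
  move=> /subnK <-; elim: (n - m)%N => // k IH x /IH.
  by rewrite addSn; left.
pose D := \bigcup_n acc n.
have DA : D `<=` A.
  move=> x [n _]; elim: n => //= n IH [/IH//|].
  by have [_ + _] := stepP n (acc n); apply.
have covS (E F : set X) : E `<=` F -> cov E `<=` cov F.
  exact: bigcup_subset.
have covo E : E `<=` A -> open (cov E).
  by move=> EA; apply: bigcup_open => d /EA/phiA[].
have AD : A `<=` cov D.
  move=> x Ax; apply: contrapT => nDx.
  have [K [cK KA KC]] := AC x Ax.
  (* Finitely many points [E] of the uncovered part of [K] cover that part; with finitely many
     points of [D] they cover [K]. *)
  have [|||E [Efin EK KE]] := @compact_finite_subcover X
      (K `\` cov D) (K `\` cov D) phi.
  - by apply: compact_closedI => //; apply: open_closedC; exact: covo.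
  - by move=> y [/KA/phiA[]].
  - by move=> y yK; exists y => //; case: yK => /KA/phiA[].
  have KDE : K `<=` cov (D `|` E).
    move=> y Ky; have [[d Dd dy]|nDy] := pselect (cov D y).
      by exists d => //; left.
    by have [//|e Ee ey] := KE y; exists e => //; right.
  have DEA : D `|` E `<=` A by move=> y [/DA//|/EK[/KA]].
  have [|||F [Ffin FDE KF]] := @compact_finite_subcover X K (D `|` E) phi.
  - exact: cK.
  - by move=> y /DEA/phiA[].
  - exact: KDE.
  have [n FnE] : exists n, F `<=` acc n `|` E.
    have : forall y, exists n, F y -> (acc n `|` E) y.
      move=> y; have [Fy|] := pselect (F y); last by exists 0.
      have [[n _ ny]|Ey] := FDE y Fy; first by exists n => _; left.
      by exists 0 => _; right.
    move=> /choice[r rP].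
    have [n rn] : exists n, forall y, F y -> (r y <= n)%N.
      have : finite_set (r @` F) by exact: finite_image.
      move=> /finite_fsetP[s sE].
      exists (\max_(i <- s) i)%N => y Fy.
      have : (r y) \in s.
        by have : [set` s] (r y) by rewrite -sE; exists y.
      by move=> ?; exact: leq_bigmax_seq.
    exists n => y Fy; have [ay|] := rP y Fy; last by right.
    by left; exact: accS (rn y Fy) _ ay.
  have [||S [CS Sx SU]] := KC (cov (acc n `|` E)).
  - apply: covo => y [ay|/EK[/KA]//]; by apply: DA; exists n.
  - by move=> y /KF; exact: covS.
  have [m nm NmS] := CN S CS n.
  (* [E] avoids [cov D], hence [cov (acc m)], so a good choice exists at step [m] and the step
     covers [N m], which contains [x]. *)
  have gE : good m (acc m) E.
    split=> //.
    - by move=> y /EK[/KA].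
    - apply/seteqP; split=> // y [/EK[_ nDy] my]; apply: nDy.
      by apply: covS my => d md; exists m.
    - rewrite NmS => y /SU[d [nd|Ed] dy]; [left|right]; exists d => //.
      exact: accS nd.
  have [_ _ _] : good m (acc m) (step m (acc m)).
    by rewrite /step; exact: (xgetI _ gE).
  rewrite NmS => /(_ x Sx) mx; apply: nDx.
  have : cov (acc m.+1) x.
    by case: mx => -[d md dx]; exists d => //=; [left|right].
  by apply: covS => d md; exists m.+1.
exists D; split=> // x.
have [Ax|nAx] := pselect (A x); last first.
  exists (~` A); first by split=> //; exact: closed_openC.
  by move=> y [nAy /DA].
have [d [n _ nd] dx] := AD x Ax.
have [phio _] := phiA d (DA d (ex_intro2 _ _ n I nd)).
(* Later steps avoid [cov (acc n)], which contains [phi d]; so [phi d] meets [D] only in the finite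
   set [acc n]. *)
have late y : D y -> phi d y -> acc n y.
  move=> [k _ ky] dy; elim: k ky => //= k IH [/IH//|sy].
  have [kn|nk] := leqP k.+1 n.
    by apply: accS kn _ _; right.
  have [_ _ /seteqP[/(_ y)+ _]] := stepP k (acc k).
  case; split=> //; exists d => //.
  by apply: accS nd.
have cR : closed (acc n `\ x).
  exact: (accessible_finite_set_closed.1 aX _ (finite_setD _ (acc_fin n))).
exists (phi d `&` ~` (acc n `\ x)).
  split; first by apply: openI => //; exact: closed_openC.
  by split=> // -[_]; apply.
move=> y [[dy nR] Dy]; apply: contrapT => yx; apply: nR; split=> //.
exact: late.
Qed.

(** * Failure of countable compactness near points outside the kernel *)

(** Finitely many open sets whose closures miss [x] cover [K], and a finite union of closures is
    closed. *)
Lemma hausdorff_compact_separate {X : topologicalType} {K : set X} {x : X} :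
  hausdorff_space X -> compact K -> ~ K x ->
  exists W, [/\ open W, K `<=` W & ~ closure W x].
Proof.
move=> hX cK nKx.
have /choice[V VP] : forall y, exists V, K y ->
    [/\ open V, V y & ~ closure V x].
  move=> y; have [Ky|] := pselect (K y); last by exists set0.
  have xy : x != y by apply/eqP => xy; apply: nKx; rewrite xy.
  have := hX; rewrite open_hausdorff => /(_ _ _ xy).
  move=> [[A V] /= [/set_mem Ax /set_mem Vy] [oA oV AV0]].
  exists V => _; split=> // /(_ A (open_nbhs_nbhs (conj oA Ax)))[z [Vz Az]].
  by have : (A `&` V) z by []; rewrite (eqP AV0).
have [||E [Efin EK KE]] := compact_finite_subcover V cK (D := K).
- by move=> y /VP[].
- by move=> y Ky; exists y => //; have [] := VP y Ky.
exists (\bigcup_(y in E) V y); split=> //.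
  by apply: bigcup_open => y /EK/VP[].
have clE : closed (\bigcup_(y in E) closure (V y)).
  by apply: closed_bigcup => // y _; exact: closed_closure.
have VE : \bigcup_(y in E) V y `<=` \bigcup_(y in E) closure (V y).
  by apply: subset_bigcup => y _; exact: subset_closure.
by move=> /(closure_subset VE)/clE[y /EK/VP[_ _]].
Qed.

(* A finite union of open sets whose closures miss [x] cannot contain
   [U `&` Y], which accumulates at [x]. *)
Lemma sigma_subset_not_countably_compact {X : topologicalType} (Y U : set X)
    (x : X) :
  hausdorff_space X -> sigma_subset Y -> closure Y x -> ~ Y x ->
  open_nbhs x U -> ~ countably_compact (set_type (U `&` Y)).
Proof.
move=> hX [C cC YC] Yx nYx Ux ccUY.
(* The [far] members cover [Y]: the compact set attached to a point of [Y] lies in [Y], hence misses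
   [x] and can be separated from it. *)
pose far N := exists W, [/\ open W, N `<=` W & ~ closure W x].
have /choice[W WP] : forall N, exists W, far N ->
    [/\ open W, N `<=` W & ~ closure W x].
  by move=> N; have [[W]|] := pselect (far N); [exists W|exists set0].
pose tr N : set (set_type (U `&` Y)) := set_val @^-1` W N.
have [|||F [Ffin FC FT]] := ccUY (tr @` (C `&` far)).
- apply: sub_countable (card_image_le _ _) _; apply: sub_countable cC.
  exact: subset_card_le.
- move=> _ [N [_ /WP[oW _ _]] <-].
  by exists (W N).
- apply/seteqP; split=> // a _; have [_ Ya] := set_valP a.
  have [K [cK KY KC]] := YC _ Ya.
  have nKx : ~ K x by move=> /KY.
  have [V [oV KV nV]] := hausdorff_compact_separate hX cK nKx.
  have [N [CN Na NV]] := KC V oV KV.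
  have farN : far N by exists V.
  exists (tr N); first by exists N.
  by have [_ NW _] := WP N farN; exact: NW.
have /choice[N0 N0P] : forall S, exists N, F S -> (C `&` far) N /\ tr N = S.
  by move=> S; have [/FC[N ? ?]|] := pselect (F S); [exists N|exists set0].
have nx : ~ (\bigcup_(S in F) closure (W (N0 S))) x.
  by move=> [S FS]; have [[_ /WP[_ _ ]]] := N0P S FS.
have cl : closed (\bigcup_(S in F) closure (W (N0 S))).
  by apply: closed_bigcup => // S _; exact: closed_closure.
have [y [Yy [Uy ny]]] : Y `&` (U `&` ~` \bigcup_(S in F) closure (W (N0 S)))
    !=set0.
  apply: Yx; apply: filterI; first exact: open_nbhs_nbhs.
  by apply: open_nbhs_nbhs; split=> //; exact: closed_openC.
have : (\bigcup_(S in F) S) (SigSub (mem_set (conj Uy Yy))) by rewrite FT.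
move=> [S FS Sy]; apply: ny; exists S => //; apply: subset_closure.
by have [_ SE] := N0P S FS; rewrite -SE in Sy.
Qed.

(** * The obstruction set and the equivalences *)

Lemma Obs_ccE {X : topologicalType} (Y : set X) :
  hausdorff_space X -> sigma_subset Y ->
  Obs_cc Y (closure Y) = set_val @^-1` ~` Y.
Proof.
move=> hX sY; apply/seteqP; split=> [x []//|x nYx]; split=> // U Ux.
by apply: sigma_subset_not_countably_compact Ux => //; exact: set_valP.
Qed.

Theorem theorem3p36 (X : topologicalType) (Y : set X)
    (HX : tychonoff_space X) (HXc : charming_space X)
    (HY : lindelof_sigma_kernel Y) :
  let B : set X := closure Y in
  let H : set (set_type B) := closure (Obs_cc Y B) in
  (forall U : set (set_type B), open U -> H `<=` U ->
     D_space (set_type (~` U)))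
  /\ (D_space (set_type B) <-> D_space (set_type H))
  /\ (D_space X <-> D_space (set_type H)).
Proof.
move=> B H.
have [_ hX] := HX; have aX := hausdorff_accessible hX.
have [/lindelof_sigma_subset sY kerY] := HY.
have vB : closed_embedding (set_val : set_type B -> X).
  by apply: set_val_closed_embedding; exact: closed_closure.
have sub_embedding (A : set (set_type B)) : closed A ->
    closed_embedding (set_val \o set_val : set_type A -> X) /\
    range (set_val \o set_val : set_type A -> X) = set_val @` A.
  move=> cA; split; last by rewrite -(image_comp set_val set_val) range_set_val.
  by apply: closed_embedding_comp vB; exact: set_val_closed_embedding.
have off_H (U : set (set_type B)) : open U -> H `<=` U ->
    D_subset (set_val @` ~` U).
  move=> oU HU; have cU : closed (set_val @` ~` U).
    by apply: closed_embedding_image vB _; exact: open_closedC.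
  apply: sigma_subset_D => //; apply: sigma_subset_closed (sY) => //.
  (* A point of [B] outside [Y] is an obstruction point, hence in [H] and in [U]. *)
  move=> _ [x nUx <-]; apply: contrapT => nYx; apply/nUx/HU/subset_closure.
  by rewrite /B Obs_ccE.
have [HE HR] := sub_embedding H (@closed_closure _ _).
have cH : closed (set_val @` H) by rewrite -HR; case: HE.
have HB : set_val @` H `<=` B by move=> _ [x _ <-]; exact: set_valP.
(* Both equivalences become statements about closed subsets of [X]. *)
rewrite (closed_embedding_D HE) HR (closed_embedding_D vB) D_subset_setT.
rewrite range_set_val.
have DHB : D_subset (set_val @` H) -> D_subset B.
  move=> DH; apply: (D_subset_glue HB DH) => U oU HU.
  (* Gluing supplies [U] open in [X]; its trace on [B] is the open set that [off_H] expects. *)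
  have -> : B `\` U = set_val @` ~` (set_val @^-1` U : set (set_type B)).
    apply/seteqP; split=> [x [Bx nUx]|_ [x nUx <-]].
      by exists (SigSub (mem_set Bx)).
    by split=> //; exact: set_valP.
  apply: off_H; first by exists U.
  by move=> x Hx; apply: HU; exists x.
split; [|split; split].
- move=> U oU HU; have [e er] := sub_embedding _ (open_closedC oU).
  by apply/(closed_embedding_D e); rewrite er; exact: off_H.
- by apply: D_subset_closed.
- exact: DHB.
- exact: D_subset_closed.
- move=> /DHB DB; apply: (D_subset_glue _ DB) => // U oU BU.
  have cU : closed (~` U) by exact: open_closedC.
  rewrite setTD; apply: sigma_subset_D => //; apply: lindelof_sigma_subset.
  by apply: kerY => // y Yy; apply/BU/subset_closure.
Qed.
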